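(* Let $n\ge100$ be an integer and $w$ be real. Then \[ \mathbb{P}\left(C(\sigma)\le\log n+w\sqrt{\log n}\right)=\Phi(w)+O\left(\frac{\log\log n}{\sqrt{\log n}}\right),\qquad\Phi(w)=\frac1{\sqrt{2\pi}}\int_{-\infty}^we^{-\frac12t^2}\,dt. \]
   Context: The probability $\mathbb{P}$ is with respect to a uniformly random permutation $\sigma$ in the symmetric group $\mathcal{S}_n$ on $\{1,\ldots,n\}$. $C(\sigma)$ is the total number of cycles of $\sigma$ (fixed points count as cycles of length 1). The constant implied by $O$ is absolute (independent of $n$ and $w$). *)

(* Defs.v *)
From mathcomp Require Import all_boot all_order all_algebra all_fingroup.
From mathcomp Require Import all_classical all_reals all_analysis.

Set Implicit Arguments.
Unset Strict Implicit.
Unset Printing Implicit Defensive.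

Import Order.TTheory GRing.Theory Num.Theory.
Import numFieldNormedType.Exports.

Local Open Scope classical_set_scope.
Local Open Scope ring_scope.

(* Permutations act on 'I_n = {0, ..., n-1} rather than {1, ..., n}; porbits s
   is the set of supports of the cycles of s, singletons (fixed points)
   included. *)
Definition cycle_count (n : nat) (s : 'S_n) : nat := #|porbits s|.

Definition uniform_perm_prob (R : realType) (n : nat) (E : pred 'S_n) : R :=
  #|[pred s : 'S_n | E s]|%:R / #|{: 'S_n}|%:R.

Definition std_normal_cdf (R : realType) (w : R) : R :=
  (Num.sqrt (2 * pi))^-1 *
  \int[lebesgue_measure]_(t in `]-oo, w]) expR (- (2^-1 * t ^+ 2)).

(* Main.v *)
From HB Require Import structures.
Require Import Defs.
From mathcomp Require Import all_boot all_order all_algebra all_fingroup.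
From mathcomp Require Import all_classical all_reals all_analysis.
From mathcomp Require Import ring lra.

Import Order.TTheory GRing.Theory Num.Theory.
Import numFieldNormedType.Exports.

Local Open Scope classical_set_scope.
Local Open Scope ring_scope.

(** The number of cycles of a uniform permutation of n points is distributed as
    a sum S of independent Bernoulli variables X_i of parameters 1 / (i + 1),
    i < n: each permutation of n + 1 points is obtained exactly once from a
    permutation s of n points by adding a fixed point and multiplying by a
    transposition of this point with one of the n + 1 points, and the number of
    cycles grows by one if this transposition is trivial and stays the same
    otherwise (cycle_count_tperm_lift_perm, sum_perm_recl).

    The mean and the variance of S are both ln n + O(1), so the estimate is a
    Berry-Esseen bound for S, of order 1 / sqrt (ln n); the stated order follows
    since ln (ln n) >= 1 for n >= 100.  The bound is obtained by Stein's method.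
    Write L = ln n, W = (S - L) / sqrt L, and let f be the bounded solution of
    f'(x) = x f(x) + 1_(x <= w) - Phi(w), so that P(W <= w) - Phi(w) is the mean
    of f'(W) - W f(W).  For each g,
       E[(S - E S) g(S)] = sum_i p_i (1 - p_i) E[g(S - X_i + 1) - g(S - X_i)]
    (bernoulli_sum_mean_covariance).  For g(j) = f((j - L) / sqrt L) the
    right-hand side is close to sqrt L E[f'(W)], because the increments of g are
    values of f' / sqrt L at points within 1 / sqrt L of W
    (stein_solution_increment).  Only the jump of f' at w prevents these values
    from being within O((1 + |W|) / L) of f'(W) / sqrt L.  The probability that
    S - X_i falls on this jump is controlled, on average over i with the weights
    p_i (1 - p_i) / L, by the same identity, applied to the indicator of
    j > L + w sqrt L: the average is at most E|S - E S| / L, which is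
    O(1 / sqrt L).  The boundedness of f, x f(x) and f' rests on the bound
    (1 - Phi(x)) (1 + x) <= 4/3 phi(x) for x >= 0 (mills_ratio_le). *)

(** * Cycles of a permutation of n + 1 points *)

Lemma lift_permX (n : nat) (s : 'S_n) (k : nat) :
  (lift_perm ord0 ord0 s ^+ k)%g = lift_perm ord0 ord0 (s ^+ k)%g.
Proof.
elim: k => [|k IHk]; first by rewrite !expg0 lift_perm1.
by rewrite !expgS IHk lift_permM.
Qed.

Lemma porbit_lift_perm_ord0 (n : nat) (s : 'S_n) :
  porbit (lift_perm ord0 ord0 s) ord0 = [set ord0]%SET.
Proof.
apply/setP=> y; rewrite inE; apply/porbitP/eqP => [[k ->]|->].
  by rewrite lift_permX lift_perm_id.
by exists 0%N; rewrite expg0 perm1.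
Qed.

Lemma porbit_lift_perm_lift (n : nat) (s : 'S_n) (x : 'I_n) :
  porbit (lift_perm ord0 ord0 s) (lift ord0 x) = (lift ord0 @: porbit s x)%SET.
Proof.
apply/setP=> y; apply/porbitP/imsetP => [[k ->]|[z /porbitP[k ->] ->]].
  by exists ((s ^+ k)%g x); rewrite ?mem_porbit// lift_permX lift_perm_lift.
by exists k; rewrite lift_permX lift_perm_lift.
Qed.

Lemma cycle_count_lift_perm (n : nat) (s : 'S_n) :
  cycle_count (lift_perm ord0 ord0 s) = (cycle_count s).+1.
Proof.
pose L (A : {set 'I_n}) : {set 'I_n.+1} := (lift ord0 @: A)%SET.
have Linj : injective L by exact/imset_inj/lift_inj.
have -> : cycle_count (lift_perm ord0 ord0 s) =
    #|([set ord0] |: (L @: porbits s))%SET|.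
  rewrite /cycle_count; congr #|pred_of_set _|; apply/setP=> A.
  rewrite in_setU1; apply/imsetP/orP => [[y _ ->]|].
    case: (unliftP ord0 y) => [x|] ->; last first.
      by left; rewrite porbit_lift_perm_ord0.
    by right; rewrite porbit_lift_perm_lift; do 2 apply: imset_f.
  case=> [/eqP->|/imsetP[_ /imsetP[x _ ->] ->]].
    by exists ord0; rewrite // porbit_lift_perm_ord0.
  by exists (lift ord0 x); rewrite // porbit_lift_perm_lift.
rewrite cardsU1 card_imset// /cycle_count.
suff -> : [set ord0]%SET \notin (L @: porbits s)%SET by [].
apply/imsetP=> -[B _ /setP/(_ ord0)]; rewrite !inE eqxx => /esym/imsetP[x _].
by move/eqP; rewrite (negbTE (neq_lift _ _)).
Qed.

(** If i is not ord0, then ord0 is a fixed point of the second factor, and the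
    transposition merges it into the cycle of i. *)
Lemma cycle_count_tperm_lift_perm (n : nat) (s : 'S_n) (i : 'I_n.+1) :
  cycle_count (tperm ord0 i * lift_perm ord0 ord0 s)%g =
  (cycle_count s + (i == ord0))%N.
Proof.
have := porbits_mul_tperm (lift_perm ord0 ord0 s) ord0 i.
rewrite -!/(cycle_count _) cycle_count_lift_perm porbit_sym.
rewrite porbit_lift_perm_ord0 inE (eq_sym ord0).
case: eqP => _ /=; first by rewrite !addn0 addn1.
by rewrite addn2 !addn1 addn0 => -[].
Qed.

(** Every permutation u of n + 1 points is tperm ord0 i composed with an
    extension of a permutation of n points, for a unique i: the point that u
    sends to ord0. *)
Lemma sum_perm_recl (V : nmodType) (n : nat) (F : 'S_n.+1 -> V) :
  \sum_(u : 'S_n.+1) F u =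
  \sum_(i : 'I_n.+1) \sum_(s : 'S_n) F (tperm ord0 i * lift_perm ord0 ord0 s)%g.
Proof.
pose h (q : 'I_n.+1 * 'S_n) : 'S_n.+1 :=
  (tperm ord0 q.1 * lift_perm ord0 ord0 q.2)%g.
have h_inj : injective h.
  move=> [i s] [j t]; rewrite /h/= => hst.
  have := congr1 (fun u : 'S_n.+1 => u i) hst.
  rewrite !permM tpermR lift_perm_id -{1}(lift_perm_id ord0 ord0 t).
  move=> /perm_inj/esym ji.
  have ij : i = j by rewrite -(tpermK ord0 j i) ji tpermL.
  move: hst; rewrite ij => /mulgI lst; congr pair.
  apply/permP=> x; apply: (@lift_inj _ ord0).
  by rewrite -!(lift_perm_lift ord0) lst.
rewrite pair_big /= (reindex h) //=; apply: onW_bij.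
apply: inj_card_bij h_inj _.
by rewrite card_prod card_ord !card_Sn factS.
Qed.

(** * Sums of independent Bernoulli variables *)

(** The mean of f(S), where S is the number of successes in n independent
    trials with success probabilities p 0, ..., p (n - 1), computed by
    conditioning on the last trial.  This recursion replaces a probability
    space carrying the trials: it is also the form in which S appears for
    random permutations. *)
Fixpoint bernoulli_sum_mean {R : realFieldType} (p : nat -> R) (n : nat)
    (f : nat -> R) : R :=
  if n is m.+1 then
    p m * bernoulli_sum_mean p m (fun j => f j.+1)
    + (1 - p m) * bernoulli_sum_mean p m f
  else f 0%N.

(** This is the sum over i < n of p i (1 - p i) times the mean of f(S - X_i),
    where S - X_i counts the successes in all trials but the i-th one. *)
Fixpoint leave_one_out_sum {R : realFieldType} (p : nat -> R) (n : nat)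
    (f : nat -> R) : R :=
  if n is m.+1 then
    p m * (1 - p m) * bernoulli_sum_mean p m f
    + (p m * leave_one_out_sum p m (fun j => f j.+1)
       + (1 - p m) * leave_one_out_sum p m f)
  else 0.

Section BernoulliSum.
Context {R : realFieldType} (p : nat -> R) (p01 : forall i, 0 <= p i <= 1).
Local Notation E := (bernoulli_sum_mean p).
Local Notation V := (leave_one_out_sum p).
Implicit Types (f g : nat -> R) (c : R) (n : nat).

Lemma bernoulli_sum_mean_lin n c f g :
  E n (fun j => c * f j + g j) = c * E n f + E n g.
Proof. by elim: n f g => [//|n IHn] f g /=; rewrite !IHn; ring. Qed.

Lemma bernoulli_sum_mean_cst n c : E n (fun=> c) = c.
Proof. by elim: n => [//|n /= ->]; ring. Qed.

Lemma eq_bernoulli_sum_mean n f g : f =1 g -> E n f = E n g.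
Proof. by move=> /funext ->. Qed.

Lemma ler_bernoulli_sum_mean n f g : (forall j, f j <= g j) -> E n f <= E n g.
Proof.
elim: n f g => [|n IHn] f g fg /=; first exact: fg.
have /andP[p0 p1] := p01 n.
by apply: lerD; apply: ler_wpM2l; rewrite ?subr_ge0//; apply: IHn.
Qed.

Lemma bernoulli_sum_meanB n f g :
  E n (fun j => f j - g j) = E n f - E n g.
Proof.
have := bernoulli_sum_mean_lin n (-1) g f; rewrite mulN1r addrC => <-.
by apply: eq_bernoulli_sum_mean => j; ring.
Qed.

Lemma bernoulli_sum_meanZ n c f : E n (fun j => c * f j) = c * E n f.
Proof.
have := bernoulli_sum_mean_lin n c f (fun=> 0).
rewrite bernoulli_sum_mean_cst addr0 => <-.
by apply: eq_bernoulli_sum_mean => j; rewrite addr0.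
Qed.

Lemma norm_bernoulli_sum_mean n f c :
  (forall j, `|f j| <= c) -> `|E n f| <= c.
Proof.
move=> fc; rewrite ler_norml -{1}(bernoulli_sum_mean_cst n (- c)).
rewrite -{2}(bernoulli_sum_mean_cst n c).
by apply/andP; split; apply: ler_bernoulli_sum_mean => j;
  have := fc j; rewrite ler_norml => /andP[].
Qed.

Lemma leave_one_out_sum_lin n c f g :
  V n (fun j => c * f j + g j) = c * V n f + V n g.
Proof.
elim: n f g => [|n IHn] f g /=; first by ring.
by rewrite !IHn bernoulli_sum_mean_lin; ring.
Qed.

Lemma leave_one_out_sum_cst n c :
  V n (fun=> c) = c * \sum_(i < n) p i * (1 - p i).
Proof.
elim: n => [|n IHn] /=; first by rewrite big_ord0 mulr0.
by rewrite bernoulli_sum_mean_cst IHn big_ord_recr/=; ring.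
Qed.

(** The contribution of the i-th trial is the covariance of X_i with
    f((S - X_i) + X_i), where S - X_i is independent of X_i: for X_i of
    parameter p i, it is p i (1 - p i) times the increment of f at S - X_i. *)
Lemma bernoulli_sum_mean_covariance n f :
  E n (fun j => (j%:R - \sum_(i < n) p i) * f j) =
  V n (fun j => f j.+1 - f j).
Proof.
elim: n f => [|n IHn] f /=; first by rewrite big_ord0 subrr mul0r.
rewrite -!IHn big_ord_recr/= bernoulli_sum_meanB.
set s := \sum_(i < n) p i.
have -> : E n (fun j => (j.+1%:R - (s + p n)) * f j.+1) =
    (1 - p n) * E n (fun j => f j.+1) + E n (fun j => (j%:R - s) * f j.+1).
  rewrite -bernoulli_sum_mean_lin; apply: eq_bernoulli_sum_mean => j.
  by rewrite -natr1; ring.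
have -> : E n (fun j => (j%:R - (s + p n)) * f j) =
    (- p n) * E n f + E n (fun j => (j%:R - s) * f j).
  rewrite -bernoulli_sum_mean_lin; apply: eq_bernoulli_sum_mean => j.
  by ring.
ring.
Qed.

(** S is either S - X_i or S - X_i + 1, so f(S - X_i) <= g(S) in both cases. *)
Lemma leave_one_out_sum_le n f g :
  (forall j, f j <= g j) -> (forall j, f j <= g j.+1) ->
  V n f <= (\sum_(i < n) p i * (1 - p i)) * E n g.
Proof.
elim: n f g => [|n IHn] f g fg fgS /=; first by rewrite big_ord0 mul0r.
have /andP[p0 p1] := p01 n; have q0 : 0 <= 1 - p n by rewrite subr_ge0.
rewrite big_ord_recr/= [leRHS]mulrDl [leRHS]addrC; apply: lerD.
  apply: ler_wpM2l; first exact: mulr_ge0.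
  have -> : E n f = p n * E n f + (1 - p n) * E n f by ring.
  by apply: lerD; apply: ler_wpM2l => //; apply: ler_bernoulli_sum_mean.
rewrite [leRHS]mulrDr [X in _ <= X + _]mulrCA [X in _ <= _ + X]mulrCA.
by apply: lerD; apply: ler_wpM2l => //; apply: IHn.
Qed.

Lemma leave_one_out_sum_dist n f g r :
  (forall j, `|g j - f j| <= r j) -> (forall j, `|g j.+1 - f j| <= r j) ->
  `|V n f - (\sum_(i < n) p i * (1 - p i)) * E n g| <= V n r.
Proof.
move=> gf gSf; rewrite ler_distl; apply/andP; split.
  have := @leave_one_out_sum_le n (fun j => -1 * f j + (-1 * r j + 0))
    (fun j => -1 * g j).
  rewrite !leave_one_out_sum_lin leave_one_out_sum_cst mul0r.
  rewrite bernoulli_sum_meanZ.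
  move=> H; suff : -1 * V n f + (-1 * V n r + 0) <=
      (\sum_(i < n) p i * (1 - p i)) * (-1 * E n g) by lra.
  by apply: H => j; [have := gf j | have := gSf j]; rewrite ler_norml; lra.
have := @leave_one_out_sum_le n (fun j => -1 * r j + f j) g.
rewrite leave_one_out_sum_lin => H.
suff : -1 * V n r + V n f <= (\sum_(i < n) p i * (1 - p i)) * E n g by lra.
by apply: H => j; [have := gf j | have := gSf j]; rewrite ler_norml; lra.
Qed.

Lemma bernoulli_sum_mean_sqr n c :
  E n (fun j => (j%:R - c) ^+ 2) =
  \sum_(i < n) p i * (1 - p i) + (\sum_(i < n) p i - c) ^+ 2.
Proof.
set lam := \sum_(i < n) p i.
have Elin : E n (fun j => j%:R - lam) = 0.
  transitivity (E n (fun j => (j%:R - lam) * 1)).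
    by apply: eq_bernoulli_sum_mean => j; rewrite mulr1.
  by rewrite bernoulli_sum_mean_covariance subrr leave_one_out_sum_cst mul0r.
have Esqr : E n (fun j => (j%:R - lam) * (j%:R - lam)) =
    \sum_(i < n) p i * (1 - p i).
  rewrite (bernoulli_sum_mean_covariance n (fun j => j%:R - lam)).
  have -> : (fun j => j.+1%:R - lam - (j%:R - lam)) = (fun=> 1 : R).
    by apply/funext => j; rewrite -natr1; ring.
  by rewrite leave_one_out_sum_cst mul1r.
have -> : E n (fun j => (j%:R - c) ^+ 2) =
    E n (fun j => 1 * ((j%:R - lam) * (j%:R - lam)) +
      (2 * (lam - c) * (j%:R - lam) + (lam - c) ^+ 2)).
  by apply: eq_bernoulli_sum_mean => j; ring.
rewrite !bernoulli_sum_mean_lin Esqr Elin bernoulli_sum_mean_cst; ring.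
Qed.

End BernoulliSum.

(** * Cycle counts as sums of Bernoulli variables *)

Lemma sum_perm_cycle_count (R : realFieldType) (n : nat) (f : nat -> R) :
  \sum_(s : 'S_n) f (cycle_count s) =
  n`!%:R * bernoulli_sum_mean (fun i => i.+1%:R^-1) n f.
Proof.
elim: n f => [|n IHn] f.
  rewrite (eq_bigr (fun=> f 0%N)) => [|s _].
    by rewrite sumr_const /= card_Sn fact0 mul1r mulr1n.
  congr f; rewrite /cycle_count; apply/eqP; rewrite cards_eq0.
  apply/eqP/setP => A; rewrite inE; apply/imsetP => -[[]].
  by [].
rewrite sum_perm_recl big_ord_recl factS natrM.
rewrite (eq_bigr (fun s : 'S_n => f (cycle_count s).+1)) => [|s _]; last first.
  by rewrite cycle_count_tperm_lift_perm eqxx addn1.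
rewrite (IHn (fun j => f j.+1)).
rewrite (eq_bigr (fun=> n`!%:R * bernoulli_sum_mean (fun i => i.+1%:R^-1) n f)).
  rewrite sumr_const card_ord -mulr_natl /=.
  have n0 : n.+1%:R != 0 :> R by rewrite pnatr_eq0.
  by rewrite -natr1 in n0 *; field.
move=> i _; rewrite -IHn; apply: eq_bigr => s _.
by rewrite cycle_count_tperm_lift_perm eq_sym (negbTE (neq_lift _ _)) addn0.
Qed.

Lemma uniform_perm_prob_cycle_count (R : realType) (n : nat) (Q : pred nat) :
  uniform_perm_prob R (fun s : 'S_n => Q (cycle_count s)) =
  bernoulli_sum_mean (fun i => i.+1%:R^-1) n (fun j => (Q j)%:R).
Proof.
rewrite /uniform_perm_prob.
have -> : #|[pred s : 'S_n | Q (cycle_count s)]|%:R =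
    \sum_(s : 'S_n) (Q (cycle_count s))%:R :> R.
  rewrite -sum1_card natr_sum big_mkcond; apply: eq_bigr => s _ /=.
  by rewrite inE; case: (Q _).
rewrite (@sum_perm_cycle_count R n (fun j => (Q j)%:R)) -cardsT cardsT card_Sn.
by rewrite mulrAC divff ?mul1r// pnatr_eq0 -lt0n fact_gt0.
Qed.

(** * The standard normal distribution *)

Section Normal.
Context {R : realType}.
Implicit Types (x y w e : R).
Local Notation mu := lebesgue_measure.
Local Notation Phi := (@std_normal_cdf R).
Local Notation phi := (normal_pdf (0 : R) 1).

Lemma std_normal_pdfE x :
  phi x = (Num.sqrt (2 * pi))^-1 * expR (- (2^-1 * x ^+ 2)).
Proof.
rewrite normal_pdfE ?oner_neq0// /normal_peak /normal_fun subr0 expr1n mul1r.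
by rewrite mulr_natl; congr (_ * expR _); lra.
Qed.

Lemma std_normal_pdf_gt0 x : 0 < phi x.
Proof.
rewrite std_normal_pdfE mulr_gt0 ?expR_gt0// invr_gt0 sqrtr_gt0.
by rewrite mulr_gt0 ?pi_gt0.
Qed.

Lemma std_normal_pdfN x : phi (- x) = phi x.
Proof. by rewrite !std_normal_pdfE sqrrN. Qed.

Lemma is_derive_std_normal_pdf x : is_derive x 1 phi (- x * phi x).
Proof.
have -> : phi = (fun x => (Num.sqrt (2 * pi))^-1 * expR (- (2^-1 * x ^+ 2))).
  by apply/funext => y; rewrite std_normal_pdfE.
pose g := (fun y : R => - (2^-1 * y ^+ 2)).
have dg : is_derive x 1 g (- x).
  apply: is_derive_eq; rewrite /GRing.scale/=; lra.
have := is_derive1_comp (is_derive_expR (g x)) dg.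
move=> /(is_deriveZ (Num.sqrt (2 * pi))^-1) h.
have -> : (fun x => (Num.sqrt (2 * pi))^-1 * expR (- (2^-1 * x ^+ 2))) =
  (Num.sqrt (2 * pi))^-1 *: (expR \o g) by apply/funext.
apply: (is_derive_eq h).
rewrite /GRing.scale/=; ring.
Qed.

Lemma integrable_std_normal_pdf y : mu.-integrable `]-oo, y] (EFin \o phi).
Proof.
by apply: (integrableS measurableT) => //; exact: integrable_normal_pdf.
Qed.

Lemma std_normal_cdf_pdf x : Phi x = \int[mu]_(t in `]-oo, x]) phi t.
Proof.
set c := Num.sqrt (2 * pi) : R.
have c0 : c != 0 by rewrite gt_eqF// sqrtr_gt0 mulr_gt0 ?pi_gt0.
have phiE t : expR (- (2^-1 * t ^+ 2)) = c * phi t.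
  by rewrite std_normal_pdfE mulVKf.
rewrite /std_normal_cdf -/c; under eq_Rintegral do rewrite phiE.
rewrite RintegralZl//; last exact: integrable_std_normal_pdf.
by rewrite mulKf.
Qed.

Lemma is_derive_std_normal_cdf x : is_derive x 1 Phi (phi x).
Proof.
have -> : Phi = fun x => \int[mu]_(t in `]-oo, x]) phi t.
  by apply/funext => y; rewrite std_normal_cdf_pdf.
have [||||dF <-] := @continuous_FTC1 R phi -oo%O x (x + 1).
- by rewrite ltrDl.
- exact: integrable_std_normal_pdf.
- by rewrite ltNyr.
- by apply: continuous_normal_pdf; rewrite oner_neq0.
- by rewrite derive1E; exact/derivableP.
Qed.

Lemma std_normal_cdfE x : (Phi x)%:E = normal_prob (0 : R) 1 `]-oo, x].
Proof.
rewrite std_normal_cdf_pdf /Rintegral /normal_prob fineK//.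
by apply: integrable_fin_num => //; exact: integrable_std_normal_pdf.
Qed.

Let idTR : measurableTypeR R -> R := idfun.
#[local] HB.instance Definition _ :=
  @isMeasurableFun.Build _ _ _ _ idTR (@measurable_id _ _ setT).

Let fine_cdf :
  fine \o cdf (idTR : {RV (normal_prob (0 : R) 1) >-> R}) = Phi.
Proof. by apply/funext => y; rewrite /= /cdf/= -std_normal_cdfE. Qed.

Lemma cvg_std_normal_cdfy1 : Phi y @[y --> +oo] --> (1 : R).
Proof. by rewrite -fine_cdf; exact/fine_cvg/cvg_cdfy1. Qed.

Lemma cvg_std_normal_cdfNy0 : Phi y @[y --> -oo] --> (0 : R).
Proof. by rewrite -fine_cdf; exact/fine_cvg/cvg_cdfNy0. Qed.

(** Phi(y) + Phi(-y) has derivative phi(y) - phi(-y) = 0, and its limit at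
    infinity is 1. *)
Lemma std_normal_cdfN x : Phi (- x) = 1 - Phi x.
Proof.
pose h y := Phi y + Phi (- y).
have dh y : is_derive y (1 : R) h 0.
  have dN :=
    is_derive1_comp (is_derive_std_normal_cdf (- y)) (is_deriveNid y 1).
  apply: (is_derive_eq (is_deriveD (is_derive_std_normal_cdf y) dN)).
  by rewrite std_normal_pdfN mulrN1 subrr.
have hx : h y @[y --> +oo] --> h x.
  have -> : h = cst (h x) by apply/funext => y; exact: is_derive_0_is_cst.
  exact: cvg_cst.
have h1 : h y @[y --> +oo] --> (1 + 0 : R).
  apply: cvgD; first exact: cvg_std_normal_cdfy1.
  by move: cvg_std_normal_cdfNy0; rewrite cvgNy_compNP.
have : h x = 1 + 0 by apply: cvg_unique hx h1.
rewrite /h; lra.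
Qed.

Lemma std_normal_cdf_ge0 x : 0 <= Phi x.
Proof. by rewrite -lee_fin std_normal_cdfE. Qed.

Lemma std_normal_cdf_le1 x : Phi x <= 1.
Proof.
by have := std_normal_cdf_ge0 (- x); rewrite std_normal_cdfN subr_ge0.
Qed.

Lemma std_normal_cdf_homo : {homo Phi : x y / x <= y}.
Proof.
move=> x y xy; rewrite -lee_fin !std_normal_cdfE.
by apply: le_measure; rewrite ?inE//; exact: subset_itvl.
Qed.

(** The function D = 4/3 phi(y) / (1 + y) + Phi(y) tends to 1 and is
    nonincreasing on the nonnegative half-line, so that D(x) >= 1. *)
Lemma mills_ratio_le x : 0 <= x -> (1 - Phi x) * (1 + x) <= 4 / 3 * phi x.
Proof.
move=> x0.
pose D y := 4 / 3 * (phi y * (1 + y)^-1) + Phi y.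
have dD y : 0 <= y -> is_derive y (1 : R) D
    (4 / 3 * (phi y * (- (1 + y) ^- 2) + (1 + y)^-1 * (- y * phi y)) + phi y).
  move=> y0; have y1 : 1 + y != 0 by rewrite gt_eqF//; lra.
  have dl : is_derive y (1 : R) (fun z : R => 1 + z) 1.
    by apply: is_derive_eq; rewrite add0r mulr1.
  have dV := is_deriveV y1 dl.
  have dM := is_deriveM (is_derive_std_normal_pdf y) dV.
  have dS := is_deriveD (is_deriveZ (4 / 3) dM) (is_derive_std_normal_cdf y).
  apply: (is_derive_eq dS).
  by rewrite /GRing.scale/=; ring.
have D_nincr y : x <= y -> D y <= D x.
  move=> xy; apply: (@ler0_derive1_nincry _ D 0) => // [z|z|].
  - by rewrite in_itv/= andbT => /ltW/dD[].
  - rewrite in_itv/= andbT => /ltW z0; rewrite derive1E.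
    have [_ ->] := dD _ z0.
    have z1 : 0 < 1 + z by lra.
    (* 4/3 is the least constant for which the numerator keeps its sign for
       z >= 0; it is then a square. *)
    have -> : 4 / 3 * (phi z * (- (1 + z) ^- 2) +
        (1 + z)^-1 * (- z * phi z)) + phi z =
      - (phi z * ((1 - z) ^+ 2 / (3 * (1 + z) ^+ 2))).
      by field; rewrite gt_eqF.
    rewrite oppr_le0 mulr_ge0 ?divr_ge0 ?sqr_ge0 ?mulr_ge0 ?sqr_ge0 ?(ltW z1)//.
    exact/ltW/std_normal_pdf_gt0.
  - have cD : {in `[0, +oo[%classic, continuous D}.
      move=> z; rewrite inE/= in_itv/= andbT => /dD[dz _].
      exact/differentiable_continuous/derivable1_diffP.
    exact: continuous_in_subspaceT cD.
have D1 : 1 <= D x.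
  rewrite leNgt; apply/negP => Dx1.
  have Phi_big := cvgr_gt _ cvg_std_normal_cdfy1 _ Dx1.
  have : \forall y \near +oo, x <= y /\ D x < Phi y.
    near=> y; split; near: y; last exact: Phi_big.
    by apply: nbhs_pinfty_ge; exact: num_real.
  move=> /filter_ex[y [xy]]; rewrite ltNge => /negP; apply.
  apply: le_trans (D_nincr y xy); rewrite lerDr.
  rewrite mulr_ge0// mulr_ge0 ?invr_ge0//; last by lra.
  exact/ltW/std_normal_pdf_gt0.
move: D1; rewrite /D => D1; have x1 : 0 < 1 + x by lra.
rewrite -ler_pdivlMr// -mulrA; lra.
Unshelve. all: by end_near. Qed.

End Normal.

(** * The solution of Stein's equation *)

Definition lower_mills_ratio {R : realType} (x : R) : R :=
  std_normal_cdf x / normal_pdf 0 1 x.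

(** This is the bounded solution f of f'(x) = x f(x) + 1_(x <= w) - Phi(w),
    where f'(w) is the left derivative.  The factors Phi(-w) = 1 - Phi(w) and
    Phi(w) make both branches agree at w. *)
Definition stein_solution {R : realType} (w x : R) : R :=
  if x <= w then std_normal_cdf (- w) * lower_mills_ratio x
  else std_normal_cdf w * lower_mills_ratio (- x).

Section SteinSolution.
Context {R : realType}.
Implicit Types (x y w a b c h : R).
Local Notation Phi := (@std_normal_cdf R).
Local Notation phi := (normal_pdf (0 : R) 1).
Local Notation m := (@lower_mills_ratio R).
Local Notation f := (@stein_solution R).

Lemma is_derive_lower_mills_ratio x : is_derive x 1 m (1 + x * m x).
Proof.
have phi0 : phi x != 0 by rewrite gt_eqF ?std_normal_pdf_gt0.
have dV := is_deriveV phi0 (is_derive_std_normal_pdf x).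
apply: (is_derive_eq (is_deriveM (is_derive_std_normal_cdf x) dV)).
by rewrite /lower_mills_ratio /GRing.scale/=; field.
Qed.

Lemma lower_mills_ratio_ge0 x : 0 <= m x.
Proof. by rewrite divr_ge0 ?std_normal_cdf_ge0// ltW// std_normal_pdf_gt0. Qed.

Lemma lower_mills_ratio_le x : x <= 0 -> m x * (1 - x) <= 4 / 3.
Proof.
move=> x0; rewrite mulrAC ler_pdivrMr ?std_normal_pdf_gt0//.
have := mills_ratio_le (- x); rewrite std_normal_cdfN subKr std_normal_pdfN.
by apply; rewrite oppr_ge0.
Qed.

Lemma std_normal_cdf_lower_mills_ratio x :
  Phi (- x) * m x = Phi x * m (- x).
Proof. by rewrite /lower_mills_ratio std_normal_pdfN mulrCA. Qed.

(** The reflection x -> -x exchanges the two branches, which reduces each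
    statement about x > w to one about x <= w. *)
Lemma stein_solutionN w x : f (- w) (- x) = f w x.
Proof.
rewrite /stein_solution lerN2 !opprK; case: ltgtP => // ->.
by rewrite std_normal_cdf_lower_mills_ratio.
Qed.

Lemma stein_solution_ge0 w x : 0 <= f w x.
Proof.
rewrite /stein_solution; case: ifP => _;
by rewrite mulr_ge0 ?std_normal_cdf_ge0 ?lower_mills_ratio_ge0.
Qed.

(** For 0 <= x <= w the ratio Phi(x) / phi(x) is not bounded, but the factor
    Phi(-w) <= Phi(-x) turns it into the upper ratio, which is. *)
Lemma stein_solution_le w x : f w x * (1 + `|x|) <= 4 / 3.
Proof.
wlog xw : w x / x <= w.
  move=> H; have [xw|/ltW wx] := leP x w; first exact: H.
  by rewrite -stein_solutionN -normrN; apply: H; rewrite lerN2.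
rewrite /stein_solution xw; have [x0|/ltW x0] := leP x 0.
  rewrite ler0_norm//; apply: le_trans (lower_mills_ratio_le _ x0).
  rewrite -mulrA ler_piMl ?std_normal_cdf_le1//.
  by rewrite mulr_ge0 ?lower_mills_ratio_ge0//; lra.
rewrite ger0_norm//.
have nx0 : - x <= 0 by lra.
apply: le_trans (lower_mills_ratio_le _ nx0); rewrite opprK.
apply: ler_wpM2r; first lra.
apply: (@le_trans _ _ (Phi (- x) * m x)).
  by rewrite ler_wpM2r ?lower_mills_ratio_ge0// std_normal_cdf_homo// lerN2.
rewrite std_normal_cdf_lower_mills_ratio ler_piMl ?std_normal_cdf_le1//.
exact: lower_mills_ratio_ge0.
Qed.

Lemma stein_solution_ub w x : f w x <= 4 / 3.
Proof.
apply: le_trans (stein_solution_le w x).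
by rewrite ler_peMr ?stein_solution_ge0// lerDl.
Qed.

Lemma norm_mul_stein_solution_le w x : `|x * f w x| <= 4 / 3.
Proof.
apply: le_trans (stein_solution_le w x).
rewrite normrM (ger0_norm (stein_solution_ge0 _ _)) mulrC.
by apply: ler_wpM2l; rewrite ?stein_solution_ge0// lerDr.
Qed.

(** With c = 1_(x <= w) - Phi(w), this bounds the derivative of the solution. *)
Lemma norm_mul_stein_solutionD_le w x c :
  `|c| <= 1 -> `|x * f w x + c| <= 7 / 3.
Proof.
move=> c1; have := norm_mul_stein_solution_le w x.
by have := ler_normD (x * f w x) c; lra.
Qed.

Lemma norm_indicator_subr_cdf_le w x : `|(x <= w)%R%:R - Phi w| <= 1.
Proof.
have := std_normal_cdf_ge0 w; have := std_normal_cdf_le1 w.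
by case: (x <= w) => /= ? ?; rewrite ler_norml; apply/andP; split; lra.
Qed.

Lemma stein_solution_MVT_left w a b : a < b -> b <= w ->
  exists2 c, a < c < b &
    f w b - f w a = (b - a) * (c * f w c + 1 - Phi w).
Proof.
move=> ab bw.
have dm x : is_derive x 1 m (1 + x * m x) := is_derive_lower_mills_ratio x.
have [|c] := MVT ab (fun x _ => dm x).
  
  apply: continuous_subspaceT => x; have [dx _] := dm x.
  exact/differentiable_continuous/derivable1_diffP.
rewrite in_itv/= => /andP[ac cb] dmab; exists c; first by rewrite ac.
have cw : c <= w by rewrite (le_trans (ltW cb)).
rewrite /stein_solution bw cw (le_trans (ltW ab) bw) -mulrBr dmab.
rewrite std_normal_cdfN; ring.
Qed.

Lemma stein_solution_MVT_right w a b : a < b -> w <= a ->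
  exists2 c, a < c < b &
    f w b - f w a = (b - a) * (c * f w c - Phi w).
Proof.
move=> ab wa.
have [||c /andP[bc ca] fab] :=
  @stein_solution_MVT_left (- w) (- b) (- a).
- by rewrite ltrN2.
- by rewrite lerN2.
exists (- c); first by apply/andP; split; lra.
move: fab; rewrite -[in X in _ = X](opprK c) !stein_solutionN.
rewrite std_normal_cdfN; lra.
Qed.

Lemma stein_solution_lip w a b : a <= b -> `|f w b - f w a| <= 7 / 3 * (b - a).
Proof.
have Phi01 := conj (std_normal_cdf_ge0 w) (std_normal_cdf_le1 w).
have left y z : y <= z -> z <= w -> `|f w z - f w y| <= 7 / 3 * (z - y).
  rewrite le_eqVlt => /predU1P[-> _|yz zw].
    by rewrite !subrr normr0 mulr0.
  have [c _ ->] := stein_solution_MVT_left _ _ _ yz zw.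
  rewrite normrM gtr0_norm ?subr_gt0// mulrC ler_wpM2r//; first lra.
  by rewrite -addrA norm_mul_stein_solutionD_le// ger0_norm; lra.
have right y z : y <= z -> w <= y -> `|f w z - f w y| <= 7 / 3 * (z - y).
  rewrite le_eqVlt => /predU1P[-> _|yz zw].
    by rewrite !subrr normr0 mulr0.
  have [c _ ->] := stein_solution_MVT_right _ _ _ yz zw.
  rewrite normrM gtr0_norm ?subr_gt0// mulrC ler_wpM2r//; first lra.
  by rewrite norm_mul_stein_solutionD_le// normrN ger0_norm; lra.
move=> ab; have [bw|/ltW wb] := leP b w; first exact: left.
have [aw|/ltW wa] := leP a w; last exact: right.
have := left _ _ aw (lexx w); have := right _ _ wb (lexx w).
have := ler_distD (f w w) (f w b) (f w a); lra.
Qed.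

(** Away from w the difference quotient is a value of the derivative in the
    interval, by the mean value theorem, and x f(x) varies by O(h (1 + |a|)).
    The last term is nonzero only when w lies in the interval from a to a + h,
    where the uniform bound on the derivative is used instead.  It is written
    as a difference so that its mean can be computed by summation by parts. *)
Lemma stein_solution_increment w a h y : 0 < h <= 1 -> a <= y <= a + h ->
  `|y * f w y + (y <= w)%R%:R - Phi w - (f w (a + h) - f w a) / h|
  <= 4 * h * (1 + `|a|) + 6 * ((a <= w)%R%:R - (a + h <= w)%R%:R).
Proof.
move=> /andP[h0 h1] /andP[ay yah].
have ah : a < a + h by rewrite ltrDl.
have lip := stein_solution_lip w.
have close c : a < c < a + h -> `|y * f w y - c * f w c| <= 4 * h * (1 + `|a|).
  move=> /andP[ac cah].
  have -> : y * f w y - c * f w c =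
    (y - c) * f w c + y * (f w y - f w c) by ring.
  have yc : `|y - c| <= h by rewrite ler_norml; apply/andP; split; lra.
  have fyc : `|f w y - f w c| <= 7 / 3 * h.
    have [le_yc|/ltW le_cy] := leP y c.
      by rewrite distrC; apply: le_trans (lip _ _ le_yc) _; lra.
    by apply: le_trans (lip _ _ le_cy) _; lra.
  have fc : `|f w c| <= 4 / 3.
    by rewrite ger0_norm ?stein_solution_ge0// stein_solution_ub.
  have ya : `|y| <= `|a| + 1.
    have -> : y = a + (y - a) by ring.
    apply: le_trans (ler_normD _ _) _; rewrite lerD2l ger0_norm; lra.
  have t1 : `|(y - c) * f w c| <= h * (4 / 3) by rewrite normrM ler_pM.
  have t2 : `|y * (f w y - f w c)| <= (`|a| + 1) * (7 / 3 * h).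
    by rewrite normrM ler_pM.
  have := ler_normD ((y - c) * f w c) (y * (f w y - f w c)).
  have : 0 <= h * `|a| by rewrite mulr_ge0 ?(ltW h0).
  lra.
have hE c : (a + h - a) * c / h = c by field; rewrite gt_eqF.
have [ahw|wah] := leP (a + h) w.
  rewrite (le_trans (ltW ah) ahw) (le_trans yah ahw).
  have [c ac ->] := stein_solution_MVT_left _ _ _ ah ahw.
  rewrite hE /= subrr mulr0 addr0; apply: le_trans (close c ac).
  by rewrite le_eqVlt; apply/orP; left; apply/eqP; congr `|_|; ring.
have [aw|wa] := leP a w; last first.
  have ahw' := ltW wa.
  rewrite (lt_geF (lt_le_trans wa ay)) ?(lt_geF wa).
  have [c ac ->] := stein_solution_MVT_right _ _ _ ah ahw'.
  rewrite hE /= subrr mulr0 !addr0; apply: le_trans (close c ac).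
  by rewrite le_eqVlt; apply/orP; left; apply/eqP; congr `|_|; ring.
have Q : `|(f w (a + h) - f w a) / h| <= 7 / 3.
  rewrite normrM normfV (gtr0_norm h0) ler_pdivrMr//.
  by apply: le_trans (lip _ _ (ltW ah)) _; rewrite addrAC subrr add0r.
have P0 : 0 <= 4 * h * (1 + `|a|) by rewrite !mulr_ge0// ?addr_ge0// ltW.
have := norm_mul_stein_solutionD_le w y _ (norm_indicator_subr_cdf_le w y).
have := ler_normB (y * f w y + ((y <= w)%R%:R - Phi w))
  ((f w (a + h) - f w a) / h).
rewrite addrA /=; lra.
Qed.

End SteinSolution.

(** * Normal approximation *)

(** Stein's equation tolerates a centering and a scaling that are close to the
    mean and the variance: the discrepancy costs O(1 / sqrt L).  Normalizing by
    the mean and the variance would instead move w, and would require comparing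
    Phi at nearby points. *)
Theorem bernoulli_sum_normal_approximation (R : realType) (p : nat -> R)
    (n : nat) (L w : R) :
  (forall i, 0 <= p i <= 1) -> 1 <= L ->
  `|\sum_(i < n) p i - L| <= 1 ->
  \sum_(i < n) p i * (1 - p i) <= L <= \sum_(i < n) p i * (1 - p i) + 2 ->
  `|bernoulli_sum_mean p n (fun j => (j%:R <= L + w * Num.sqrt L)%R%:R)
    - std_normal_cdf w| <= 26 / Num.sqrt L.
Proof.
move=> p01 L1.
set E := bernoulli_sum_mean p n; set V := leave_one_out_sum p n.
set lam := \sum_(i < n) p i; set s2 := \sum_(i < n) p i * (1 - p i).
move=> lamL /andP[s2L Ls2].
have s2_ge0 : 0 <= s2.
  apply: sumr_ge0 => i _; have /andP[? ?] := p01 i.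
  by rewrite mulr_ge0// subr_ge0.
set s : R := Num.sqrt L; pose h : R := s^-1.
have s1 : 1 <= s by rewrite -(sqrtr1 R) ler_wsqrtr.
have s0 : 0 < s by lra.
have Ls : L = s ^+ 2 by rewrite sqr_sqrtr//; lra.
have h0 : 0 < h by rewrite invr_gt0.
have hs : h * s = 1 by rewrite mulVf// gt_eqF.
have h1 : h <= 1 by rewrite invf_le1.
rewrite -/h.
pose x (j : nat) : R := (j%:R - L) * h.
have xS j : x j.+1 = x j + h by rewrite /x -natr1; ring.
pose v j : R := (x j <= w)%R%:R.
have -> : (fun j : nat => (j%:R <= L + w * s)%R%:R) = v.
  apply/funext => j; rewrite /v /x ler_pdivrMr//; congr (nat_of_bool _)%:R.
  by rewrite lerBlDl.
pose F j := stein_solution w (x j).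
pose Phi := std_normal_cdf w.
pose G j : R := x j * F j + v j - Phi.
pose g j := (F j.+1 - F j) / h.
pose r j : R := 4 * h * (1 + `|x j|) + 6 * (v j - v j.+1).
have hh : 0 < h <= 1 by rewrite h0.
have gr1 j : `|G j - g j| <= r j.
  have xj : x j <= x j <= x j + h by rewrite lexx lerDl ltW.
  by have := stein_solution_increment w _ _ _ hh xj; rewrite -(xS j).
have gr2 j : `|G j.+1 - g j| <= r j.
  have xj : x j <= x j.+1 <= x j + h by rewrite xS lexx lerDl ltW.
  by have := stein_solution_increment w _ _ _ hh xj; rewrite -(xS j).
have VG : `|V g - s2 * E G| <= V r by exact: leave_one_out_sum_dist.
have Ex2 : E (fun j => x j ^+ 2) <= 2.
  have -> : (fun j => x j ^+ 2) = (fun j => h ^+ 2 * (j%:R - L) ^+ 2).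
    by apply/funext => j; rewrite /x exprMn mulrC.
  rewrite /E bernoulli_sum_meanZ bernoulli_sum_mean_sqr -/s2 -/lam.
  have : (lam - L) ^+ 2 <= 1.
    by move: lamL; rewrite ler_norml => /andP[? ?]; nra.
  have : h ^+ 2 * (s ^+ 2) = 1 by rewrite -exprMn hs expr1n.
  have := sqr_ge0 h; rewrite -Ls; nra.
have Ex : E (fun j => `|x j|) <= 3 / 2.
  apply: (@le_trans _ _ (E (fun j => 2^-1 * x j ^+ 2 + 2^-1))).
    apply: ler_bernoulli_sum_mean => // j.
    rewrite -(real_normK (num_real (x j))).
    by have := sqr_ge0 (`|x j| - 1); nra.
  by rewrite /E bernoulli_sum_mean_lin bernoulli_sum_mean_cst -/(E _); lra.
have Vx : V (fun j => `|x j|) <= s2 * (3 / 2 + h).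
  have : V (fun j => 1 * `|x j| + (- h)) <= s2 * E (fun j => `|x j|).
    apply: leave_one_out_sum_le => // j; first by lra.
    by have := ler_normB (x j + h) h; rewrite xS addrK (gtr0_norm h0); lra.
  rewrite /V leave_one_out_sum_lin leave_one_out_sum_cst -/s2 -/(V _).
  have := ler_wpM2l s2_ge0 Ex; lra.
(* Concentration: this is the weighted probability that a step of S - X_i
   crosses the threshold w. By the covariance identity it equals
   - E[(S - lam) v(S)], at most E|S - lam|; the bound on the latter by the
   second moment is |y| <= (h y^2 + s) / 2, where h s = 1. *)
have Vv : V (fun j => v j - v j.+1) <= s.
  have -> : V (fun j => v j - v j.+1) = - V (fun j => v j.+1 - v j).
    have -> : (fun j => v j - v j.+1) = (fun j => -1 * (v j.+1 - v j) + 0).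
      by apply/funext => j; ring.
    by rewrite /V leave_one_out_sum_lin leave_one_out_sum_cst; ring.
  rewrite /V -bernoulli_sum_mean_covariance -/lam -mulN1r -bernoulli_sum_meanZ.
  apply: (@le_trans _ _ (E (fun j => h / 2 * (j%:R - lam) ^+ 2 + s / 2))).
    apply: ler_bernoulli_sum_mean => // j.
    set y := j%:R - lam; rewrite /v.
    have : 0 <= h * (y + s) ^+ 2 by rewrite mulr_ge0 ?sqr_ge0// ltW.
    have -> : h * (y + s) ^+ 2 =
      h * y ^+ 2 + 2 * (h * s) * y + (h * s) * s by ring.
    have : 0 <= h * y ^+ 2 by rewrite mulr_ge0 ?sqr_ge0// ltW.
    rewrite hs; case: (x j <= w) => /=; lra.
  rewrite /E bernoulli_sum_mean_lin bernoulli_sum_mean_cst.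
  rewrite bernoulli_sum_mean_sqr -/lam -/s2 subrr expr0n /= addr0.
  have : h * s2 <= h * (s ^+ 2) by rewrite ler_pM2l// -Ls.
  have -> : h * s ^+ 2 = (h * s) * s by ring.
  rewrite hs; lra.
have Vr : V r <= 20 * s.
  have -> : V r =
      4 * h * (s2 + V (fun j => `|x j|)) + 6 * V (fun j => v j - v j.+1).
    have -> : r = (fun j => 6 * (v j - v j.+1) + (4 * h * `|x j| + 4 * h)).
      by apply/funext => j; rewrite /r; ring.
    by rewrite /V !leave_one_out_sum_lin leave_one_out_sum_cst -/s2; ring.
  have : 4 * h * (s2 + V (fun j => `|x j|)) <= 14 * (h * s * s).
    have : s2 + V (fun j => `|x j|) <= 7 / 2 * s ^+ 2.
      rewrite -Ls; have := ler_wpM2l s2_ge0 h1; lra.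
    move/(ler_wpM2l (ltW h0)).
    have -> : h * (7 / 2 * s ^+ 2) = 7 / 2 * (h * s * s) by ring.
    lra.
  rewrite hs; lra.
have EG : `|E G| <= 7 / 3.
  apply: norm_bernoulli_sum_mean => // j; rewrite /G -addrA.
  exact/norm_mul_stein_solutionD_le/norm_indicator_subr_cdf_le.
have EF : `|E F| <= 4 / 3.
  apply: norm_bernoulli_sum_mean => // j.
  by rewrite ger0_norm ?stein_solution_ge0// stein_solution_ub.
have Vg : V g = s * E (fun j => (j%:R - lam) * F j).
  rewrite /E bernoulli_sum_mean_covariance.
  have -> : g = (fun j => s * (F j.+1 - F j) + 0).
    by apply/funext => j; rewrite /g /h invrK; ring.
  by rewrite /V leave_one_out_sum_lin leave_one_out_sum_cst mul0r addr0.
set A := E (fun j => (j%:R - lam) * F j) in Vg.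
(* By definition of G, v - Phi is G - x F; the mean of x F differs from h A
   only through the centering at L instead of lam. *)
have -> : E v - Phi = E G - h * A - (lam - L) * h * E F.
  have -> : E v = 1 * E G + (- h * A + (- ((lam - L) * h) * E F + Phi)).
    rewrite /A /E -[X in _ + (_ + (_ + X))](bernoulli_sum_mean_cst p n Phi).
    rewrite -!bernoulli_sum_mean_lin.
    by apply: eq_bernoulli_sum_mean => j; rewrite /G /x; ring.
  by ring.
have -> : E G - h * A = h ^+ 2 * ((L - s2) * E G - (V g - s2 * E G)).
  have -> : h ^+ 2 * ((L - s2) * E G - (V g - s2 * E G)) =
      (h * s) ^+ 2 * E G - h * (h * s) * A.
    by rewrite Vg Ls; ring.
  by rewrite hs; ring.
apply: le_trans (ler_normB _ _) _.
have t1 : `|(lam - L) * h * E F| <= h * (4 / 3).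
  rewrite !normrM (gtr0_norm h0) ler_pM ?mulr_ge0 ?(ltW h0)//.
  by rewrite ler_piMl ?(ltW h0).
have t2 : `|(L - s2) * E G| <= 2 * (7 / 3).
  by rewrite normrM ler_pM// ger0_norm; lra.
have t3 := ler_normB ((L - s2) * E G) (V g - s2 * E G).
have t4 : `|h ^+ 2 * ((L - s2) * E G - (V g - s2 * E G))| <=
    h ^+ 2 * (14 / 3 + 20 * s).
  rewrite normrM (ger0_norm (sqr_ge0 h)) ler_wpM2l ?sqr_ge0//; lra.
have : h ^+ 2 * (14 / 3 + 20 * s) = 14 / 3 * (h * h) + 20 * h * (h * s) by ring.
have := ler_wpM2l (ltW h0) h1; rewrite hs; lra.
Qed.

(** * Mean and variance of the number of cycles *)

Lemma harmonic_ln_bounds (R : realType) (n : nat) :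
  ln n.+2%:R <= (\sum_(i < n.+1) i.+1%:R^-1 : R) <= 1 + ln n.+1%:R.
Proof.
elim: n => [|n /andP[lo hi]].
  rewrite big_ord1 ln1 invr1 addr0 lexx andbT.
  by have -> : 2%:R = 1 + 1 :> R by []; rewrite le_ln1Dx//; lra.
rewrite big_ord_recr /=.
set b : R := n.+2%:R in lo *.
have -> : n.+3%:R = b + 1 :> R by rewrite natr1.
have {}hi : (\sum_(i < n.+1) i.+1%:R^-1 : R) <= 1 + ln (b - 1).
  by apply: le_trans hi _; rewrite /b -(natr1 n.+1) addrK.
have b2 : 2 <= b by rewrite ler_nat.
have up : ln (b - 1) - ln b <= - b^-1.
  rewrite -ln_div ?posrE//; [|lra..].
  have -> : (b - 1) / b = 1 + - b^-1 by field; rewrite gt_eqF//; lra.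
  by apply: le_ln1Dx; rewrite ltrN2 invf_lt1//; lra.
have dn : ln (b + 1) - ln b <= b^-1.
  rewrite -ln_div ?posrE//; [|lra..].
  have -> : (b + 1) / b = 1 + b^-1 by field; rewrite gt_eqF//; lra.
  by apply: le_ln1Dx; apply: (@lt_le_trans _ _ 0); [lra|rewrite invr_ge0; lra].
by clearbody b; apply/andP; split; lra.
Qed.

Lemma sum_inv_sqr_bounds (R : realFieldType) (n : nat) :
  1 <= \sum_(i < n.+1) (i.+1%:R^-1 ^+ 2 : R) <= 2 - n.+1%:R^-1.
Proof.
elim: n => [|n /andP[lo hi]]; first by rewrite big_ord1 invr1 expr1n; lra.
rewrite big_ord_recr /=.
set b : R := n.+2%:R.
have {}hi : \sum_(i < n.+1) (i.+1%:R^-1 ^+ 2 : R) <= 2 - (b - 1)^-1.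
  by apply: le_trans hi _; rewrite /b -(natr1 n.+1) addrK.
have b2 : 2 <= b by rewrite ler_nat.
have -> : 2 - b^-1 = 2 - (b - 1)^-1 + b^-1 ^+ 2 + (b ^+ 2 * (b - 1))^-1.
  by field; rewrite !gt_eqF//; lra.
have q1 : 0 <= b^-1 ^+ 2 by exact: sqr_ge0.
have q2 : 0 <= (b ^+ 2 * (b - 1))^-1.
  by rewrite invr_ge0 mulr_ge0 ?sqr_ge0//; lra.
by clearbody b; apply/andP; split; lra.
Qed.

(** Since e^(1/4) <= 4/3, e^4 <= (4/3)^16 < 100 and e <= (4/3)^4 < 4. *)
Lemma lnln_ge1 (R : realType) (n : nat) :
  (100 <= n)%N -> 1 <= ln (ln n%:R) :> R.
Proof.
move=> n100.
have e14 : expR 4^-1 <= 4 / 3 :> R.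
  have := expRxMexpNx_1 (4^-1 : R); have := expR_ge1Dx (- 4^-1 : R).
  have := expR_gt0 (4^-1 : R); nra.
have e1 : expR 1 <= 4 :> R.
  have -> : 1 = 4%:R * 4^-1 :> R by lra.
  rewrite expRM_natl; apply: (@le_trans _ _ ((4 / 3) ^+ 4)); last lra.
  by rewrite lerXn2r ?nnegrE ?expR_ge0//; lra.
have e4 : expR 4 <= n%:R :> R.
  apply: (@le_trans _ _ 100%:R); last by rewrite ler_nat.
  have -> : 4 = 16%:R * 4^-1 :> R by lra.
  rewrite expRM_natl; apply: (@le_trans _ _ ((4 / 3) ^+ 16)); last lra.
  by rewrite lerXn2r ?nnegrE ?expR_ge0//; lra.
have n0 : 0 < n%:R :> R by rewrite ltr0n (leq_trans _ n100).
have ln4 : 4 <= ln n%:R :> R by rewrite -(expRK 4) ler_ln ?posrE ?expR_gt0.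
rewrite -[leLHS](expRK 1) ler_ln ?posrE ?expR_gt0//; last lra.
exact: le_trans ln4.
Qed.

(** * The number of cycles of a random permutation *)

Theorem theorem1p22 (R : realType) :
  exists K : R, 0 < K /\
    forall (n : nat) (w : R), (100 <= n)%N ->
      `| uniform_perm_prob R
           (fun s : 'S_n =>
              (cycle_count s)%:R <= ln (n%:R : R) + w * Num.sqrt (ln n%:R))
         - std_normal_cdf w |
      <= K * (ln (ln n%:R) / Num.sqrt (ln n%:R)).
Proof.
exists 26; split=> // n w n100.
have lnln := lnln_ge1 R _ n100.
have ln1 : 1 <= ln n%:R :> R.
  by rewrite leNgt; apply/negP => /ltW/ln_le0; lra.
set L : R := ln n%:R.
rewrite (uniform_perm_prob_cycle_count R n
  (fun j => j%:R <= L + w * Num.sqrt L)).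
apply: (@le_trans _ _ (26 / Num.sqrt L)); last first.
  by rewrite ler_pM2l// ler_peMl ?invr_ge0 ?sqrtr_ge0.
case: n n100 @L lnln ln1 => [//|n] n100 L lnln ln1.
have /andP[lo hi] := harmonic_ln_bounds R n.
have /andP[lo2 hi2] := sum_inv_sqr_bounds R n.
have lnS : L <= ln n.+2%:R by rewrite ler_ln ?posrE ?ltr0n// ler_nat.
have varE : \sum_(i < n.+1) (i.+1%:R^-1 : R) * (1 - i.+1%:R^-1) =
    \sum_(i < n.+1) (i.+1%:R^-1 : R) - \sum_(i < n.+1) (i.+1%:R^-1 ^+ 2 : R).
  by rewrite -sumrB; apply: eq_bigr => i _; ring.
have inv0 : 0 <= n.+1%:R^-1 :> R by rewrite invr_ge0.
set H : R := \sum_(i < n.+1) i.+1%:R^-1 in lo hi varE.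
set Q : R := \sum_(i < n.+1) i.+1%:R^-1 ^+ 2 in lo2 hi2 varE.
have Q2 : Q <= 2 by apply: le_trans hi2 _; rewrite gerBl.
have lam : `|H - L| <= 1.
  move: lo hi lnS; rewrite -/L; clearbody H L => lo hi lnS.
  by rewrite ler_norml; apply/andP; split; lra.
have var : H - Q <= L <= H - Q + 2.
  move: lo hi lnS lo2 Q2; rewrite -/L; clearbody H L Q => lo hi lnS lo2 Q2.
  by apply/andP; split; lra.
apply: bernoulli_sum_normal_approximation => //; last by rewrite varE.
by move=> i; rewrite invr_ge0 ler0n invf_le1// ler1n.
Qed.
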